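(* Let $K$ be a field. For each nonzero (finite or infinite) cardinal $\kappa$ there exists a directed graph $E$ such that the Leavitt path algebra $L_K(E)$ has exactly $\kappa$ distinct isomorphism classes of simple right $L_K(E)$-modules.
   Context: A directed graph $E=(E^0,E^1,r,s)$ consists of a set $E^0$ of vertices, a set $E^1$ of edges and maps $r,s:E^1\to E^0$ (range and source); there are no restrictions on the cardinalities of $E^0$, $E^1$ or of the sets $s^{-1}(v)$. A vertex $v$ is regular if $0<|s^{-1}(v)|<\infty$. Given a field $K$, the Leavitt path algebra $L_K(E)$ is the (not necessarily unital) $K$-algebra generated by pairwise orthogonal idempotents $\{v:v\in E^0\}$ and elements $\{e,e^*:e\in E^1\}$ subject to: (1) $s(e)e=e=er(e)$; (2) $r(e)e^*=e^*=e^*s(e)$; (3) $e^*e=r(e)$ and $e^*f=0$ for edges $e\ne f$; (4) $v=\sum_{e\in E^1,\,s(e)=v}ee^*$ for every regular vertex $v$. A right module $S$ over a ring $R$ (not necessarily unital) is simple if $SR\neq 0$ and $S$ has no submodules other than $0$ and $S$. *)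

(* Defs.v *)
From HB Require Import structures.
From Stdlib Require List.
From mathcomp Require Import all_boot all_order all_algebra all_classical.

Set Implicit Arguments.
Unset Strict Implicit.
Unset Printing Implicit Defensive.

Import GRing.Theory.
Local Open Scope ring_scope.
Local Open Scope classical_set_scope.

(** * Not necessarily unital rings and algebras *)

HB.mixin Record Zmodule_isRng R of GRing.Zmodule R := {
  rngmul : R -> R -> R;
  rngmulA : associative rngmul;
  rngmulDl : left_distributive rngmul +%R;
  rngmulDr : right_distributive rngmul +%R
}.

#[short(type="rngType")]
HB.structure Definition Rng := {R of Zmodule_isRng R & GRing.Zmodule R}.

Notation "x ** y" := (rngmul x y) (at level 40, left associativity).

HB.mixin Record Lmodule_Rng_isNuAlgebra (K : fieldType) A
    of GRing.Lmodule K A & Rng A := {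
  nuscaleAl : forall (a : K) (x y : A), a *: (x ** y) = (a *: x) ** y;
  nuscaleAr : forall (a : K) (x y : A), a *: (x ** y) = x ** (a *: y)
}.

#[short(type="nuAlgType")]
HB.structure Definition NuAlgebra (K : fieldType) :=
  {A of Lmodule_Rng_isNuAlgebra K A & GRing.Lmodule K A & Rng A}.

(** * Right modules *)

HB.mixin Record Zmodule_isRmodule (R : rngType) M of GRing.Zmodule M := {
  ract : M -> R -> M;
  ractA : forall m x y, ract (ract m x) y = ract m (x ** y);
  ractDl : forall m n x, ract (m + n) x = ract m x + ract n x;
  ractDr : forall m x y, ract m (x + y) = ract m x + ract m y
}.

#[short(type="rmodType")]
HB.structure Definition Rmodule (R : rngType) :=
  {M of Zmodule_isRmodule R M & GRing.Zmodule M}.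

Notation "m <* x" := (ract m x) (at level 40, left associativity).

Section RightModules.
Variable R : rngType.

Definition submodule (S : rmodType R) (N : set S) : Prop :=
  [/\ N 0,
      forall m n, N m -> N n -> N (m + n),
      forall m, N m -> N (- m) &
      forall m x, N m -> N (m <* x)].

(** The submodule SR of all finite sums of products. *)
Definition module_prod (S : rmodType R) : set S :=
  [set m | exists l : seq (S * R)%type, m = \sum_(p <- l) p.1 <* p.2].
Arguments module_prod : clear implicits.

Definition simple_module (S : rmodType R) : Prop :=
  module_prod S <> [set 0] /\
  forall N : set S, submodule N -> N = [set 0] \/ N = [set: S].

Definition rmod_iso (S T : rmodType R) : Prop :=
  exists f : {additive S -> T},
    bijective f /\ forall m x, f (m <* x) = f m <* x.

(** The isomorphism classes of simple modules.  They are bare predicates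
    rather than [set]s: [set (rmodType R)] would put the carriers of modules
    in a strictly smaller universe than the carriers of rings. *)
Definition simple_iso_class : Type :=
  {C : rmodType R -> Prop |
    exists2 S : rmodType R, simple_module S & C = rmod_iso S}.

End RightModules.
Arguments module_prod [R] S.
Arguments simple_iso_class : clear implicits.

Definition equipotent (A B : Type) : Prop := exists f : A -> B, bijective f.

(** A ring as a right module over itself.  In particular, module carriers may
    be as large as ring carriers. *)
Section RegularModule.
Variable R : rngType.

Definition regular_rmod : Type := R.

HB.instance Definition _ := GRing.Zmodule.on regular_rmod.
HB.instance Definition _ := Zmodule_isRmodule.Build R regular_rmod
  (fun m x y => esym (rngmulA (m : R) x y))
  (fun m n x => rngmulDl (m : R) n x)
  (fun m x y => rngmulDr (m : R) x y).

End RegularModule.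

(** * Directed graphs *)

Record digraph := Digraph {
  vertex : Type;
  edge : Type;
  rng : edge -> vertex;
  src : edge -> vertex
}.

Definition regular (E : digraph) (v : vertex E) : Prop :=
  [set e | src e = v] !=set0 /\ finite_set [set e : edge E | src e = v].

(** * Leavitt path algebras *)

(** L_K(E) is given by its presentation: formal nonunital K-algebra
    expressions in the generators v, e, e^*, modulo the smallest congruence
    containing the axioms of K-algebras and the defining relations. *)
Section LeavittPathAlgebra.
Variables (K : fieldType) (E : digraph).

Inductive lpa_term : Type :=
| tvertex of vertex E
| tedge of edge E
| tghost of edge E
| tzero
| tadd of lpa_term & lpa_term
| topp of lpa_term
| tscale of K & lpa_term
| tmul of lpa_term & lpa_term.

Definition tsum (l : seq lpa_term) : lpa_term := foldr tadd tzero l.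

Inductive lpa_rel : lpa_term -> lpa_term -> Prop :=
(* congruence *)
| lpa_refl x : lpa_rel x x
| lpa_sym x y : lpa_rel x y -> lpa_rel y x
| lpa_trans x y z : lpa_rel x y -> lpa_rel y z -> lpa_rel x z
| lpa_congD x x' y y' :
    lpa_rel x x' -> lpa_rel y y' -> lpa_rel (tadd x y) (tadd x' y')
| lpa_congN x x' : lpa_rel x x' -> lpa_rel (topp x) (topp x')
| lpa_congZ a x x' : lpa_rel x x' -> lpa_rel (tscale a x) (tscale a x')
| lpa_congM x x' y y' :
    lpa_rel x x' -> lpa_rel y y' -> lpa_rel (tmul x y) (tmul x' y')
(* axioms of nonunital K-algebras *)
| lpa_addA x y z : lpa_rel (tadd x (tadd y z)) (tadd (tadd x y) z)
| lpa_addC x y : lpa_rel (tadd x y) (tadd y x)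
| lpa_add0 x : lpa_rel (tadd tzero x) x
| lpa_addN x : lpa_rel (tadd (topp x) x) tzero
| lpa_scaleA a b x : lpa_rel (tscale a (tscale b x)) (tscale (a * b) x)
| lpa_scale1 x : lpa_rel (tscale 1 x) x
| lpa_scaleDr a x y :
    lpa_rel (tscale a (tadd x y)) (tadd (tscale a x) (tscale a y))
| lpa_scaleDl a b x :
    lpa_rel (tscale (a + b) x) (tadd (tscale a x) (tscale b x))
| lpa_mulA x y z : lpa_rel (tmul x (tmul y z)) (tmul (tmul x y) z)
| lpa_mulDl x y z : lpa_rel (tmul (tadd x y) z) (tadd (tmul x z) (tmul y z))
| lpa_mulDr x y z : lpa_rel (tmul x (tadd y z)) (tadd (tmul x y) (tmul x z))
| lpa_scaleAl a x y : lpa_rel (tscale a (tmul x y)) (tmul (tscale a x) y)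
| lpa_scaleAr a x y : lpa_rel (tscale a (tmul x y)) (tmul x (tscale a y))
(* the vertices are pairwise orthogonal idempotents *)
| lpa_idem v : lpa_rel (tmul (tvertex v) (tvertex v)) (tvertex v)
| lpa_orth v w : v <> w -> lpa_rel (tmul (tvertex v) (tvertex w)) tzero
(* s(e) e = e = e r(e) *)
| lpa_src_edge e : lpa_rel (tmul (tvertex (src e)) (tedge e)) (tedge e)
| lpa_edge_rng e : lpa_rel (tmul (tedge e) (tvertex (rng e))) (tedge e)
(* r(e) e^* = e^* = e^* s(e) *)
| lpa_rng_ghost e : lpa_rel (tmul (tvertex (rng e)) (tghost e)) (tghost e)
| lpa_ghost_src e : lpa_rel (tmul (tghost e) (tvertex (src e))) (tghost e)
(* e^* e = r(e), and e^* f = 0 for e <> f *)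
| lpa_CK1 e : lpa_rel (tmul (tghost e) (tedge e)) (tvertex (rng e))
| lpa_CK1_orth e f : e <> f -> lpa_rel (tmul (tghost e) (tedge f)) tzero
(* v = \sum_(s(e) = v) e e^* for v regular; l enumerates s^{-1}(v) *)
| lpa_CK2 v l :
    regular v -> List.NoDup l -> (forall e, List.In e l <-> src e = v) ->
    lpa_rel (tvertex v) (tsum [seq tmul (tedge e) (tghost e) | e <- l]).

HB.instance Definition _ := gen_eqMixin lpa_term.
HB.instance Definition _ := gen_choiceMixin lpa_term.

Definition lpa_relb (x y : lpa_term) : bool := `[< lpa_rel x y >].

Lemma lpa_relb_equiv : equiv_class_of lpa_relb.
Proof.
split=> [x|x y|y x z]; first by apply/asboolP; exact: lpa_refl.
- by apply/asboolP/asboolP; exact: lpa_sym.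
- by move=> /asboolP xy /asboolP yz; apply/asboolP; exact: lpa_trans xy yz.
Qed.

Canonical lpa_equiv := EquivRelPack lpa_relb_equiv.

Definition LPA : Type := {eq_quot lpa_equiv}%qT.

HB.instance Definition _ := Choice.on LPA.

Definition lpa_pi (t : lpa_term) : LPA := \pi_({eq_quot lpa_equiv})%qT t.
Definition lpa_repr (x : LPA) : lpa_term :=
  repr (x : {eq_quot lpa_equiv}%qT).

Lemma lpa_reprK : cancel lpa_repr lpa_pi.
Proof. exact: reprK. Qed.

Lemma lpa_piP (s t : lpa_term) : lpa_pi s = lpa_pi t <-> lpa_rel s t.
Proof.
split=> [/eqmodP/asboolP //|st]; by apply/eqmodP/asboolP.
Qed.

Lemma lpa_repr_pi (t : lpa_term) : lpa_rel (lpa_repr (lpa_pi t)) t.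
Proof. by apply/lpa_piP; rewrite lpa_reprK. Qed.

Definition lpa_zero : LPA := lpa_pi tzero.
Definition lpa_add (x y : LPA) := lpa_pi (tadd (lpa_repr x) (lpa_repr y)).
Definition lpa_opp (x : LPA) := lpa_pi (topp (lpa_repr x)).
Definition lpa_scale (a : K) (x : LPA) := lpa_pi (tscale a (lpa_repr x)).
Definition lpa_mul (x y : LPA) := lpa_pi (tmul (lpa_repr x) (lpa_repr y)).

Lemma lpa_piD s t : lpa_pi (tadd s t) = lpa_add (lpa_pi s) (lpa_pi t).
Proof. by apply/lpa_piP/lpa_congD; apply/lpa_sym/lpa_repr_pi. Qed.
Lemma lpa_piN s : lpa_pi (topp s) = lpa_opp (lpa_pi s).
Proof. by apply/lpa_piP/lpa_congN; apply/lpa_sym/lpa_repr_pi. Qed.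
Lemma lpa_piZ a s : lpa_pi (tscale a s) = lpa_scale a (lpa_pi s).
Proof. by apply/lpa_piP/lpa_congZ; apply/lpa_sym/lpa_repr_pi. Qed.
Lemma lpa_piM s t : lpa_pi (tmul s t) = lpa_mul (lpa_pi s) (lpa_pi t).
Proof. by apply/lpa_piP/lpa_congM; apply/lpa_sym/lpa_repr_pi. Qed.

Lemma lpa_ind (P : LPA -> Prop) : (forall t, P (lpa_pi t)) -> forall x, P x.
Proof. by move=> Pt x; rewrite -(lpa_reprK x). Qed.

Fact lpa_addrA : associative lpa_add.
Proof.
elim/lpa_ind=> x; elim/lpa_ind=> y; elim/lpa_ind=> z.
by rewrite -!lpa_piD; apply/lpa_piP/lpa_addA.
Qed.
Fact lpa_addrC : commutative lpa_add.
Proof.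
elim/lpa_ind=> x; elim/lpa_ind=> y.
by rewrite -!lpa_piD; apply/lpa_piP/lpa_addC.
Qed.
Fact lpa_add0r : left_id lpa_zero lpa_add.
Proof. by elim/lpa_ind=> x; rewrite -lpa_piD; apply/lpa_piP/lpa_add0. Qed.
Fact lpa_addNr : left_inverse lpa_zero lpa_opp lpa_add.
Proof.
by elim/lpa_ind=> x; rewrite -lpa_piN -lpa_piD; apply/lpa_piP/lpa_addN.
Qed.

HB.instance Definition _ :=
  GRing.isZmodule.Build LPA lpa_addrA lpa_addrC lpa_add0r lpa_addNr.

Fact lpa_mulrA : associative lpa_mul.
Proof.
elim/lpa_ind=> x; elim/lpa_ind=> y; elim/lpa_ind=> z.
by rewrite -!lpa_piM; apply/lpa_piP/lpa_mulA.
Qed.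
Fact lpa_mulrDl : left_distributive lpa_mul +%R.
Proof.
elim/lpa_ind=> x; elim/lpa_ind=> y; elim/lpa_ind=> z.
by rewrite /+%R /= -!(lpa_piM, lpa_piD); apply/lpa_piP/lpa_mulDl.
Qed.
Fact lpa_mulrDr : right_distributive lpa_mul +%R.
Proof.
elim/lpa_ind=> x; elim/lpa_ind=> y; elim/lpa_ind=> z.
by rewrite /+%R /= -!(lpa_piM, lpa_piD); apply/lpa_piP/lpa_mulDr.
Qed.

HB.instance Definition _ :=
  Zmodule_isRng.Build LPA lpa_mulrA lpa_mulrDl lpa_mulrDr.

Fact lpa_scalerA a b (x : LPA) :
  lpa_scale a (lpa_scale b x) = lpa_scale (a * b) x.
Proof.
by elim/lpa_ind: x => x; rewrite -!lpa_piZ; apply/lpa_piP/lpa_scaleA.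
Qed.
Fact lpa_scale1r : left_id 1 lpa_scale.
Proof. by elim/lpa_ind=> x; rewrite -lpa_piZ; apply/lpa_piP/lpa_scale1. Qed.
Fact lpa_scalerDr : right_distributive lpa_scale +%R.
Proof.
move=> a; elim/lpa_ind=> x; elim/lpa_ind=> y.
by rewrite /+%R /= -!(lpa_piZ, lpa_piD); apply/lpa_piP/lpa_scaleDr.
Qed.
Fact lpa_scalerDl (x : LPA) :
  {morph lpa_scale^~ x : a b / a + b >-> (a + b : LPA)}.
Proof.
elim/lpa_ind: x => x a b.
by rewrite [RHS]/+%R /= -!(lpa_piZ, lpa_piD); apply/lpa_piP/lpa_scaleDl.
Qed.

HB.instance Definition _ := GRing.Zmodule_isLmodule.Build K LPA
  lpa_scalerA lpa_scale1r lpa_scalerDr lpa_scalerDl.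

Fact lpa_scalerAl a (x y : LPA) : a *: (x ** y) = (a *: x) ** y.
Proof.
elim/lpa_ind: x => x; elim/lpa_ind: y => y; rewrite /rngmul /*:%R /=.
by rewrite -!(lpa_piM, lpa_piZ); apply/lpa_piP/lpa_scaleAl.
Qed.
Fact lpa_scalerAr a (x y : LPA) : a *: (x ** y) = x ** (a *: y).
Proof.
elim/lpa_ind: x => x; elim/lpa_ind: y => y; rewrite /rngmul /*:%R /=.
by rewrite -!(lpa_piM, lpa_piZ); apply/lpa_piP/lpa_scaleAr.
Qed.

HB.instance Definition _ :=
  Lmodule_Rng_isNuAlgebra.Build K LPA lpa_scalerAl lpa_scalerAr.

End LeavittPathAlgebra.

(* Main.v *)
Require Import Defs.
From HB Require Import structures.
From mathcomp Require Import all_boot all_order all_algebra all_classical.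

Set Implicit Arguments.
Unset Strict Implicit.
Unset Printing Implicit Defensive.

(** Take for E the graph with vertex set kappa and no edges.  No vertex is
    regular, so L_K(E) is the direct sum of kappa copies of K, whose simple
    modules are the copies of K on which one vertex acts as the identity and
    the others as zero. *)

Import GRing.Theory.
Local Open Scope ring_scope.
Local Open Scope classical_set_scope.

(** * Right modules over a nonunital ring and their isomorphism classes *)

Section RightModuleTheory.
Variable R : rngType.
Implicit Types S T U : rmodType R.

Lemma ract0l S (x : R) : (0 : S) <* x = 0.
Proof. by apply: (addrI (0 <* x)); rewrite -ractDl !addr0. Qed.

Lemma ract0r S (m : S) : m <* 0 = 0.
Proof. by apply: (addrI (m <* 0)); rewrite -ractDr !addr0. Qed.

Lemma ractNr S (m : S) (x : R) : m <* (- x) = - (m <* x).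
Proof. by apply: (addrI (m <* x)); rewrite -ractDr !subrr ract0r. Qed.

Lemma rmod_iso_intro S T (f : S -> T) :
  {morph f : m n / m - n} -> bijective f ->
  (forall m x, f (m <* x) = f m <* x) -> rmod_iso S T.
Proof.
move=> fB fbij fA.
pose F : {additive S -> T} := HB.pack f (GRing.isZmodMorphism.Build S T f fB).
by exists F.
Qed.

Lemma rmod_iso_refl S : rmod_iso S S.
Proof. by apply: (@rmod_iso_intro S S id) => //; exists id. Qed.

Lemma rmod_iso_sym S T : rmod_iso S T -> rmod_iso T S.
Proof.
move=> [f [[g fK gK] fA]]; apply: (@rmod_iso_intro T S g).
- by move=> m n; apply: (can_inj fK); rewrite raddfB !gK.
- by exists f.
- by move=> m x; apply: (can_inj fK); rewrite fA !gK.
Qed.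

Lemma rmod_iso_trans S T U : rmod_iso S T -> rmod_iso T U -> rmod_iso S U.
Proof.
move=> [f [fbij fA]] [g [gbij gA]].
apply: (@rmod_iso_intro S U (g \o f)) => [m n||m x] /=.
- by rewrite !raddfB.
- exact: bij_comp.
- by rewrite fA gA.
Qed.

(** A class is the predicate [rmod_iso S], so by extensionality equality of classes reduces to
    [rmod_iso] being an equivalence relation. *)
Lemma rmod_iso_classP S T : (rmod_iso S = rmod_iso T) <-> rmod_iso S T.
Proof.
split=> [->|ST]; first exact: rmod_iso_refl.
apply/funext => U; apply/propext; split; last exact: rmod_iso_trans.
exact/rmod_iso_trans/rmod_iso_sym.
Qed.

Lemma simple_module_act_neq0 S :
  simple_module S -> exists (m : S) (x : R), m <* x <> 0.
Proof.
move=> [SR0 _]; apply: contrapT => nex; apply: SR0.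
apply/seteqP; split=> [m [l ->]|m ->] /=; last by exists [::]; rewrite big_nil.
by apply: big1 => p _; apply: contrapT => px; apply: nex; exists p.1, p.2.
Qed.

End RightModuleTheory.

(** Choice turns the mere existence of preimages into an inverse function. *)
Lemma inj_surj_bijective (A B : Type) (f : A -> B) :
  injective f -> (forall b, exists a, f a = b) -> bijective f.
Proof.
move=> finj /choice [g gK]; exists g => // a.
by apply: finj; rewrite gK.
Qed.

Section LpaQuotientMap.
Variables (K : fieldType) (E : digraph).
Implicit Types s t : lpa_term K E.

Lemma pi_tzero : lpa_pi (tzero K E) = 0.
Proof. by []. Qed.

Lemma pi_tadd s t : lpa_pi (tadd s t) = lpa_pi s + lpa_pi t.
Proof. exact: lpa_piD. Qed.

Lemma pi_topp s : lpa_pi (topp s) = - lpa_pi s.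
Proof. exact: lpa_piN. Qed.

Lemma pi_tscale a s : lpa_pi (tscale a s) = a *: lpa_pi s.
Proof. exact: lpa_piZ. Qed.

Lemma pi_tmul s t : lpa_pi (tmul s t) = lpa_pi s ** lpa_pi t.
Proof. exact: lpa_piM. Qed.

End LpaQuotientMap.

(** * Coordinates on the algebra of the graph without edges *)

Section Edgeless.
Variables (K : fieldType) (V : Type).

Definition edgeless : digraph := @Digraph V void (of_void V) (of_void V).

Local Notation L := (LPA K edgeless).

Definition vtx (v : V) : L := lpa_pi (tvertex K (v : vertex edgeless)).

(** Evaluation of terms under the character of [L] that sends [v] to 1 and every other vertex to 0,
    i.e. the coordinate at [v] in the direct sum of copies of [K]. *)
Fixpoint coef_term (v : V) (t : lpa_term K edgeless) : K :=
  match t with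
  | tvertex w => `[< v = w >]%:R
  | tedge e => of_void K e
  | tghost e => of_void K e
  | tzero => 0
  | tadd s t => coef_term v s + coef_term v t
  | topp s => - coef_term v s
  | tscale a s => a * coef_term v s
  | tmul s t => coef_term v s * coef_term v t
  end.

Lemma coef_term_rel v s t : lpa_rel s t -> coef_term v s = coef_term v t.
Proof.
elim=> {s t} //=.
all: try by move=> [].
all: try by move=> *; congruence.
- by move=> x y z; rewrite addrA.
- by move=> x y; rewrite addrC.
- by move=> x; rewrite add0r.
- by move=> x; rewrite addNr.
- by move=> a b x; rewrite mulrA.
- by move=> x; rewrite mul1r.
- by move=> a x y; rewrite mulrDr.
- by move=> a b x; rewrite mulrDl.
- by move=> x y z; rewrite mulrA.
- by move=> x y z; rewrite mulrDl.
- by move=> x y z; rewrite mulrDr.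
- by move=> a x y; rewrite mulrA.
- by move=> a x y; rewrite mulrCA.
- by move=> w; rewrite -natrM mulnb andbb.
- move=> w w' ww'; rewrite -natrM mulnb -asbool_and.
  by rewrite asboolF // => -[-> /ww'].
(* The relation at regular vertices is vacuous: regularity of [w] would supply an edge. *)
- by move=> w l [[[]]].
Qed.

Definition coef (v : V) (x : L) : K := coef_term v (lpa_repr x).

Lemma coef_pi v t : coef v (lpa_pi t) = coef_term v t.
Proof. exact/coef_term_rel/lpa_repr_pi. Qed.

Lemma coefD v x y : coef v (x + y) = coef v x + coef v y.
Proof.
by elim/lpa_ind: x => s; elim/lpa_ind: y => t; rewrite -pi_tadd !coef_pi.
Qed.

Lemma coefM v x y : coef v (x ** y) = coef v x * coef v y.
Proof.
by elim/lpa_ind: x => s; elim/lpa_ind: y => t; rewrite -pi_tmul !coef_pi.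
Qed.

Lemma coefZ v a x : coef v (a *: x) = a * coef v x.
Proof. by elim/lpa_ind: x => s; rewrite -pi_tscale !coef_pi. Qed.

Lemma coef_vtx v w : coef v (vtx w) = `[< v = w >]%:R.
Proof. exact: coef_pi. Qed.

Lemma coef_vtxx v : coef v (vtx v) = 1.
Proof. by rewrite coef_vtx asboolT. Qed.

Lemma vtx_orth v w : v <> w -> vtx v ** vtx w = 0.
Proof. by move=> vw; rewrite -pi_tmul -pi_tzero; exact/lpa_piP/lpa_orth. Qed.

Lemma vtx_idem v : vtx v ** vtx v = vtx v.
Proof. by rewrite -pi_tmul; exact/lpa_piP/lpa_idem. Qed.

(** The right ideal generated by [v] is the line [K v]. For a product, associativity lets the first
    factor act on [v] before the second. *)
Lemma vtxM v x : vtx v ** x = coef v x *: vtx v.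
Proof.
elim/lpa_ind: x; elim=> [w|[]|[]||s IHs t IHt|s IHs|a s IHs|s IHs t IHt].
- rewrite -/(vtx w) coef_vtx; case: asboolP => [<-|/vtx_orth->].
    by rewrite scale1r vtx_idem.
  by rewrite scale0r.
- by rewrite pi_tzero -(scale0r 0) -nuscaleAr coefZ mul0r !scale0r.
- by rewrite pi_tadd rngmulDr coefD scalerDl IHs IHt.
- by rewrite pi_topp -scaleN1r coefZ -nuscaleAr IHs scalerA.
- by rewrite pi_tscale coefZ -nuscaleAr IHs scalerA.
- by rewrite pi_tmul rngmulA IHs -nuscaleAl IHt scalerA coefM.
Qed.

(** * The one-dimensional simple module at each vertex *)

Definition vertex_module (v : V) : Type := K.

HB.instance Definition _ v := GRing.Zmodule.on (vertex_module v).

Lemma vertex_actA v (m : vertex_module v) x y :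
  (m : K) * coef v x * coef v y = (m : K) * coef v (x ** y).
Proof. by rewrite coefM mulrA. Qed.

Lemma vertex_actDr v (m : vertex_module v) x y :
  (m : K) * coef v (x + y) = (m : K) * coef v x + (m : K) * coef v y.
Proof. by rewrite coefD mulrDr. Qed.

(** The carrier is [K] for every [v]; the vertex enters only through this action, by the character
    [coef v]. *)
HB.instance Definition _ v := Zmodule_isRmodule.Build L (vertex_module v)
  (@vertex_actA v) (fun m n x => mulrDl (m : K) n (coef v x)) (@vertex_actDr v).

Lemma vertex_ractE v (m : vertex_module v) (x : L) :
  m <* x = (m : K) * coef v x.
Proof. by []. Qed.

Lemma vertex_module_simple v : simple_module (vertex_module v : rmodType L).
Proof.
split.
  move/seteqP=> [/(_ (1 : K)) sub0 _].
  have /eqP : (1 : K) = 0; last by rewrite oner_eq0.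
  apply: sub0; exists [:: (1 : K, vtx v)].
  by rewrite big_seq1 vertex_ractE coef_vtxx mulr1.
move=> N [N0 _ _ NR]; have [[m Nm m0]|N0'] := pselect (exists2 m, N m & m <> 0).
  right; apply/seteqP; split=> // n _.
  (* A nonzero [m] generates everything, since its coordinate is invertible in [K]. *)
  have -> : n = m <* (((m : K)^-1 * n) *: vtx v).
    rewrite vertex_ractE coefZ coef_vtxx mulr1 mulrA mulfV ?mul1r //.
    exact/eqP.
  exact: NR.
left; apply/seteqP; split=> [m Nm|m ->//].
by apply: contrapT => m0; apply: N0'; exists m.
Qed.

Lemma vertex_module_iso_inj v w :
  rmod_iso (vertex_module v : rmodType L) (vertex_module w) -> v = w.
Proof.
move=> [f [[g fK _] fA]]; apply: contrapT => vw.
(* [vtx v] acts as the identity on the first module and as zero on the second, so [f] would kill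
   1. *)
have := fA (1 : K) (vtx v).
rewrite !vertex_ractE coef_vtxx mulr1 coef_vtx asboolF ?mulr0 => [f10|/esym//].
have : (1 : K) = (0 : vertex_module v).
  by apply: (can_inj fK); rewrite [RHS]raddf0.
by move/eqP; rewrite oner_eq0.
Qed.

(** * Every simple module comes from a vertex *)

Lemma simple_act_vtx_neq0 (S : rmodType L) :
  simple_module S -> exists (m : S) (v : V), m <* vtx v <> 0.
Proof.
move=> /simple_module_act_neq0[m [x]].
apply: contra_notP => nex.
have {}nex n v : n <* vtx v = 0 :> S.
  by apply: contrapT => nv; apply: nex; exists n, v.
(* [S] carries no [K]-action, so the scalar [a] is kept inside the induction; at a vertex,
   [a v = v (a v)] reduces to the action of [v]. *)
suff act0 t a n : n <* (a *: lpa_pi t) = 0 :> S.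
  by elim/lpa_ind: x => t; rewrite -[lpa_pi t]scale1r act0.
elim: t a n => [v|[]|[]||s IHs t IHt|s IHs|b s IHs|s IHs t IHt] a n.
- by rewrite -/(vtx v) -vtx_idem nuscaleAr -ractA nex ract0l.
- by rewrite pi_tzero scaler0 ract0r.
- by rewrite pi_tadd scalerDr ractDr IHs IHt addr0.
- by rewrite pi_topp scalerN ractNr IHs oppr0.
- by rewrite pi_tscale scalerA IHs.
- by rewrite pi_tmul nuscaleAl -ractA IHs ract0l.
Qed.

(** If [m v] is nonzero, then [a] mapped to [m (a v)] is [L]-linear by [vtxM], and Schur's argument
    makes it bijective. *)
Lemma simple_iso_vertex_module (S : rmodType L) :
  simple_module S -> exists v, rmod_iso (vertex_module v : rmodType L) S.
Proof.
move=> Ssimple; have [m [v mv0]] := simple_act_vtx_neq0 Ssimple.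
exists v; pose f (a : vertex_module v) : S := m <* ((a : K) *: vtx v).
have fB : {morph f : a b / a - b}.
  by move=> a b; rewrite /f scalerBl ractDr ractNr.
have fA a x : f (a <* x) = f a <* x.
  by rewrite /f ractA -nuscaleAl vtxM scalerA.
have f0 : f 0 = 0 by rewrite /f scale0r ract0r.
apply: (@rmod_iso_intro _ (vertex_module v : rmodType L) S f) => //.
apply: inj_surj_bijective => [a b fab|n].
  apply/eqP; rewrite -subr_eq0; apply/negPn/negP => ab0; apply: mv0.
  (* Dividing by [a - b] carries [f (a - b) = 0] to [f 1 = 0], where [f 1 = m v]. *)
  have := fA (a - b) (((a - b : K)^-1) *: vtx v).
  rewrite fB fab subrr ract0l vertex_ractE coefZ coef_vtxx mulr1 mulfV //.
  by rewrite /f scale1r.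
have [|range0|rangeT] := Ssimple.2 (range f).
- split=> [|_ _ [a _ <-] [b _ <-]|_ [a _ <-]|_ x [a _ <-]].
  + by exists 0.
  (* Sums and opposites are written as differences, the form that [fB] handles. *)
  + by exists (a - (0 - b)); rewrite ?fB ?f0 ?sub0r ?opprK.
  + by exists (0 - a); rewrite ?fB ?f0 ?sub0r.
  + by exists (a <* x).
- have : range f (m <* vtx v) by exists (1 : K); rewrite // /f scale1r.
  by rewrite range0.
- have : range f n by rewrite rangeT.
  by move=> [a _ <-]; exists a.
Qed.

Definition vertex_class (v : V) : simple_iso_class L :=
  exist _ (rmod_iso (vertex_module v : rmodType L))
    (ex_intro2 _ _ _ (vertex_module_simple v) erefl).

Lemma vertex_class_bij : bijective vertex_class.
Proof.
apply: inj_surj_bijective => [v w [/rmod_iso_classP]|[C [S Ssimple CE]]].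
  exact: vertex_module_iso_inj.
have [v vS] := simple_iso_vertex_module Ssimple.
(* By proof irrelevance it suffices to compare the underlying predicates. *)
by exists v; apply: eq_exist; rewrite CE; exact/rmod_iso_classP.
Qed.

End Edgeless.

Theorem mainTheorem7 (K : fieldType) (kappa : Type) (hkappa : inhabited kappa) :
  exists E : digraph, equipotent kappa (simple_iso_class (LPA K E)).
Proof.
exists (edgeless kappa), (@vertex_class K kappa).
exact: vertex_class_bij.
Qed.
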